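(* Let $f$ be any endomorphism of $(\mathbb{Q},\leqslant)$. If $\operatorname{im} f$ is finite, then $f$ is regular.
   Context: $\operatorname{End}(\mathbb{Q},\leqslant)$ is the monoid, under composition, of all maps $f\colon\mathbb{Q}\to\mathbb{Q}$ such that $u\leqslant v$ implies $uf\leqslant vf$ (maps are written on the right). An element $f$ is regular if there exists $g\in\operatorname{End}(\mathbb{Q},\leqslant)$ with $fgf=f$. *)

(* Defs.v *)
From mathcomp Require Import all_boot all_order all_algebra.
From mathcomp Require Import boolp classical_sets functions cardinality.

Set Implicit Arguments.
Unset Strict Implicit.
Unset Printing Implicit Defensive.

(* Regularity in the endomorphism monoid of an ordered set. The product f g f
   is the same map whether maps are composed on the right or on the left. *)
Definition regular_endo (d : Order.disp_t) (T : porderType d)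
    (f : {omorphism T -> T}) : Prop :=
  exists g : {omorphism T -> T}, f \o g \o f =1 f.

(* Main.v *)
(* A section h of f on im f is automatically monotone, because the order is
   total. As im f is finite and nonempty, Q retracts monotonically onto it: send
   y to the largest element of im f below y, or to min (im f) if there is none.
   The composite of this retraction with h is the required g. *)
From HB Require Import structures.
Require Import Defs.
From mathcomp Require Import all_boot all_order all_algebra.
From mathcomp Require Import boolp classical_sets functions cardinality.

Set Implicit Arguments.
Unset Strict Implicit.
Unset Printing Implicit Defensive.

Import Order.TTheory.

Local Open Scope classical_set_scope.
Local Open Scope order_scope.

Lemma seq_monotone_retraction (d : Order.disp_t) (T : orderType d)
    (x0 : T) (s : seq T) : x0 \in s ->
  exists r : T -> T, [/\ {homo r : x y / x <= y}, forall y, r y \in s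
    & {in s, forall y, r y = y}].
Proof.
(* Since the default [x0] is an entry of [s], [m] is exactly the least entry of [s]. *)
move=> x0s; pose m := \big[Order.min/x0]_(v <- s) v.
have ms : m \in s.
  rewrite /m big_seq; elim/big_rec: _ => // v w vs ws.
  by rewrite minEle; case: ifP.
(* The default [m] keeps the values in [s] when no entry is below [y], and never exceeds a [y] taken
   from [s]. *)
exists (fun y => \big[Order.max/m]_(v <- s | v <= y) v); split.
- by move=> x y xy; apply: sub_bigmax => v /le_trans; apply.
- move=> y; rewrite big_seq_cond; elim/big_rec: _ => // v w /andP[vs _] ws.
  by rewrite maxEle; case: ifP.
- move=> y ys; apply/le_anti/andP; split; last exact: le_bigmax_seq.
  by apply: bigmax_le => //; apply: bigmin_inf_seq ys _ _.
Qed.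

Lemma regular_endo_retraction (d : Order.disp_t) (T : orderType d)
    (f : {omorphism T -> T}) (r : T -> T) :
  {homo r : x y / x <= y} -> (forall y, range f (r y)) ->
  (forall x, r (f x) = f x) -> regular_endo f.
Proof.
move=> r_homo r_range r_fix.
have /choice[h fh] y : exists x, f x = r y by have [x _] := r_range y; exists x.
have rr y : r (r y) = r y by have [x _ <-] := r_range y; rewrite r_fix.
(* h y need not depend only on r y; precomposing with r makes it do so. *)
pose g := h \o r.
have fg y : f (g y) = r y by rewrite /= fh rr.
have g_homo : {homo g : x y / x <= y}.
  move=> x y /r_homo; rewrite le_eqVlt => /predU1P[rxy | rxy].
    by rewrite /g /= rxy.
  (* Here [r x < r y]; were [g y < g x], applying the monotone [f] would give [r y <= r x]. *)
  by rewrite leNgt; apply/negP => /ltW /(omorph_le f); rewrite !fg leNgt rxy.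
pose gM := Order.isOrderMorphism.Build d T d T g g_homo.
pose g' : {omorphism T -> T} := HB.pack g gM.
by exists g' => x /=; rewrite [f _]fg r_fix.
Qed.

Theorem proposition3p8 (f : {omorphism rat -> rat}) :
  finite_set (range f) -> regular_endo f.
Proof.
move=> /finite_seqP[s fs].
have fsE y : range f y <-> y \in s by rewrite fs.
have f0s : f 0%R \in s by apply/fsE; exists 0%R.
have [r [r_homo rs r_fix]] := seq_monotone_retraction f0s.
apply: (regular_endo_retraction r_homo) => [y | x]; first exact/fsE.
by apply: r_fix; apply/fsE; exists x.
Qed.
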